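(* Let $M$ be a metric space, $u:M\to M$ a continuous map, and $\Lambda\subset M$ with $u(\Lambda)\subset\Lambda$. Assume that there is $\epsilon'>0$ such that for every $m\in\Lambda$ the open ball $U_m(\epsilon')=\{m'\in M:d(m',m)<\epsilon'\}$ satisfies $U_m(\epsilon')\subset X_m\times Y_m$, where $X_m,Y_m$ are complete metric spaces (the inclusion being a bi-Lipschitz embedding as explained in the context). For each $m\in\Lambda$ let $\tilde u_m:X_m\times Y_m\to X_{u(m)}\times Y_{u(m)}$ be a correspondence (with generating map) satisfying the (A$'$)$(\alpha,\lambda_u(m))$ (B)$(\beta,\lambda_s(m))$ condition and such that $u|_{U_m(\epsilon')}=\tilde u_m|_{U_m(\epsilon')}$, where $\alpha,\beta>0$ are constants and $\lambda_s,\lambda_u:\Lambda\to\mathbb R_+$ are bounded functions. Assume $\alpha\beta<1$ and $\sup_m(\lambda_s(m)+\epsilon)\lambda_u(m)<1-\alpha\beta$, where $\epsilon>0$. Then there are unique $\Lambda^s_{loc}(m,\epsilon')\subset U_m(\epsilon')$, $m\in\Lambda$, such that (1), (2) hold: (1) $m\in\Lambda^s_{loc}(m,\epsilon')$ and every $\Lambda^s_{loc}(m,\epsilon')$ is a Lipschitz graph of $X_m\to Y_m$ with Lipschitz constant at most $\beta$; (2) $u(\Lambda^s_{loc}(m,\epsilon'))\cap U_{u(m)}(\epsilon')\subset\Lambda^s_{loc}(u(m),\epsilon')$. Moreover: (3) $\{x\in U_m(\epsilon'):u^n(x)\in U_{u^n(m)}(\epsilon')\text{ for all }n,\ |u^n(x)-u^n(m)|\lesssim\varepsilon^{(n)}(m),\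 n\to\infty\}\subset\Lambda^s_{loc}(m,\epsilon')$, where $\varepsilon:\Lambda\to\mathbb R_+$ is such that $\lambda_s(m)+\epsilon<\varepsilon(m)<\lambda_u^{-1}(m)(1-\alpha\beta)$; if $u(\Lambda^s_{loc}(m,\epsilon'))\subset\Lambda^s_{loc}(u(m),\epsilon')$ for all $m\in\Lambda$, then the two sets are equal. (4) Suppose that (i) $\sup_m\lambda_s(m)+\epsilon<1$, and (ii) there is $\delta>0$ such that $|\lambda_s(m_1)-\lambda_s(m_2)|<\epsilon$ whenever $m_1,m_2\in\Lambda$, $d(m_1,m_2)<\delta$. Let $$\Lambda^s_m=\bigcup_{n\ge0}u^{-n}(\Lambda^s_{loc}(u^n(m),\epsilon'))=\{x\in M:|u^n(x)-u^n(m)|\lesssim\varepsilon_1^{(n)}(m),\ n\to\infty\},$$ where $\lambda_s(m)+\epsilon<\varepsilon_1(m)<\min\{1,\lambda_u^{-1}(m)(1-\alpha\beta)\}-\varsigma$ and $\varsigma>0$ is sufficiently small. Then $\Lambda^s=\{\Lambda^s_m:m\in\Lambda\}$ is a $u$-invariant lamination; that is, $\Lambda^s_{m_1}\cap\Lambda^s_{m_2}\ne\emptyset$ implies $\Lambda^s_{m_1}=\Lambda^s_{m_2}$, and $u(\Lambda^s_m)\subset\Lambda^s_{u(m)}$ ($\Lambda^s$ is called the strong stable lamination of $\Lambda$ for $u$).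
   Context: ''$U_m(\epsilon')\subset X_m\times Y_m$'' means there is a map $\phi_m:U_m(\epsilon')\to\phi_m(U_m(\epsilon'))\subset X_m\times Y_m$ which is bi-Lipschitz with bi-Lipschitz constant no more than a fixed constant independent of $m$; points of $U_m(\epsilon')$ are identified with their images under $\phi_m$, and the metric in $\phi_m(U_m(\epsilon'))$ is induced from $U_m(\epsilon')$ through $\phi_m$. ''$u|_{U_m(\epsilon')}=\tilde u_m|_{U_m(\epsilon')}$'' is understood through these identifications. Metrics are written $d(x,y)=|x-y|$. ''$\Lambda^s_{loc}(m,\epsilon')$ is a Lipschitz graph of $X_m\to Y_m$'' means that through $\phi_m$ it is the part lying in $U_m(\epsilon')$ of the graph of a Lipschitz map $X_m\to Y_m$. A correspondence $H:X_1\times Y_1\to X_2\times Y_2$ is a nonempty subset $\operatorname{Graph}H$ of $(X_1\times Y_1)\times(X_2\times Y_2)$; it has generating map $(F,G)$, $F:X_1\times Y_2\to X_2$, $G:X_1\times Y_2\to Y_1$, if $(x_2,y_2)\in H(x_1,y_1)\iff y_1=G(x_1,y_2),x_2=F(x_1,y_2)$. (A$'$)$(\alpha,\lambda_u)$: $\sup_x\operatorname{Lip}F(x,\cdot)\le\alpha$ and $\sup_x\operatorname{Lip}G(x,\cdot)\le\lambda_u$. (B)$(\beta,\lambda_s)$: for all $(x_1,y_1)\times(x_2,y_2)$, $(x_1',y_1')\times(x_2',y_2')\in\operatorname{Graph}H$, $|y_2-y_2'|\le\beta|x_2-x_2'|$ implies $|y_1-y_1'|\le\beta|x_1-x_1'|$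 and $|x_2-x_2'|\le\lambda_s|x_1-x_1'|$. For $\varepsilon:\Lambda\to\mathbb R_+$, $\varepsilon^{(n)}(m)=\varepsilon(u^{n-1}(m))\cdots\varepsilon(u(m))\varepsilon(m)$. $a_n\lesssim b_n$ means $\sup_{n\ge0}b_n^{-1}a_n<\infty$.
   Formalization: Uniqueness is among traces of global Lipschitz graphs that are also invariant under the correspondences; (3) also assumes sup ε(m)λ_u(m)<1−αβ; in (4) the union equals the asymptotic set only if u(Λ^s_loc(m))⊂Λ^s_loc(u(m)) (else ⊇), and the lamination is of the asymptotic sets. *)

(* Defs.v *)
From HB Require Import structures.
From mathcomp Require Import all_boot all_order all_algebra.
From mathcomp Require Import all_classical all_reals all_analysis.

Set Implicit Arguments.
Unset Strict Implicit.
Unset Printing Implicit Defensive.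

Import Order.TTheory GRing.Theory Num.Theory.

Local Open Scope classical_set_scope.
Local Open Scope ring_scope.

(* The library's [completeType] is pointed; here this only says nonempty. *)
#[short(type="completeMetricType")]
HB.structure Definition CompleteMetric (R : numDomainType) :=
  {T of Metric R T & Complete T}.

Section metric_notions.
Context {R : realType}.

(* The library puts no [metricType] structure on a product; any of the usual
   (mutually bi-Lipschitz) product distances would do. *)
Definition prod_dist (X Y : metricType R) (z w : X * Y) : R :=
  Num.max (mdist z.1 w.1) (mdist z.2 w.2).

Definition lipschitz_le (X Y : metricType R) (k : R) (f : X -> Y) : Prop :=
  forall x x', mdist (f x) (f x') <= k * mdist x x'.

Definition bilipschitz_on (M X Y : metricType R) (C : R) (A : set M)
    (f : M -> X * Y) : Prop :=
  forall p q, A p -> A q ->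
    C^-1 * mdist p q <= prod_dist (f p) (f q) <= C * mdist p q.

Definition lipschitz_graph (X Y : metricType R) (k : R) (Gamma : set (X * Y))
    : Prop :=
  exists2 f : X -> Y, lipschitz_le k f & Gamma = [set z | z.2 = f z.1].

End metric_notions.

(* A correspondence H : X1 * Y1 -> X2 * Y2 is given by its (nonempty) graph. *)
Section correspondences.
Context {R : realType} {X1 Y1 X2 Y2 : metricType R}.
Implicit Types (H : set ((X1 * Y1) * (X2 * Y2))).

Definition generating_map H (F : X1 -> Y2 -> X2) (G : X1 -> Y2 -> Y1) : Prop :=
  forall x1 y1 x2 y2,
    H ((x1, y1), (x2, y2)) <-> y1 = G x1 y2 /\ x2 = F x1 y2.

Definition condA' (alpha lambda_u : R) (F : X1 -> Y2 -> X2)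
    (G : X1 -> Y2 -> Y1) : Prop :=
  (forall x, lipschitz_le alpha (F x)) /\ (forall x, lipschitz_le lambda_u (G x)).

Definition condB (beta lambda_s : R) H : Prop :=
  forall x1 y1 x2 y2 x1' y1' x2' y2',
    H ((x1, y1), (x2, y2)) -> H ((x1', y1'), (x2', y2')) ->
    mdist y2 y2' <= beta * mdist x2 x2' ->
    mdist y1 y1' <= beta * mdist x1 x1' /\
    mdist x2 x2' <= lambda_s * mdist x1 x1'.

Definition value H (z : X1 * Y1) : set (X2 * Y2) := [set w | H (z, w)].

Definition inverse_image H (B : set (X2 * Y2)) : set (X1 * Y1) :=
  [set z | value H z `&` B !=set0].

End correspondences.

(* [lrate ab l] is l^-1 * (1 - ab); the inverse is taken in the extended reals,
   so that it is +oo for l = 0. *)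
Definition lrate {R : realType} (ab l : R) : \bar R :=
  (l%:E^-1 * (1 - ab)%:E)%E.

Definition iterprod {R : realType} {M : Type} (u : M -> M) (e : M -> R)
    (n : nat) (m : M) : R := \prod_(k < n) e (iter k u m).

Definition lesssim {R : realType} (a b : nat -> R) : Prop :=
  has_ubound [set (b n)^-1 * a n | n in [set: nat]].

Section stable_sets.
Context {R : realType} {M : metricType R} {X Y : M -> metricType R}.
Variables (u : M -> M) (Lambda : set M) (e' : R)
  (phi : forall m, M -> X m * Y m)
  (ut : forall m, set ((X m * Y m) * (X (u m) * Y (u m)))).
Arguments ut : clear implicits.

(* u restricted to U_m(e') equals ut m, wherever the identifications make sense
   of this: u x can be read as a point of X (u m) * Y (u m) when it lies in
   U_(u m)(e'), and nothing is required of the other points. *)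
Definition locally_equal : Prop :=
  forall m x, Lambda m -> ball m e' x -> ball (u m) e' (u x) ->
    value (ut m) (phi m x) = [set phi (u m) (u x)].

(* L m is the part in U_m(e') of the global graph Gamma m. The local invariance
   of L under u does not by itself make L unique: for u (x, y) = (2x, 4y) on
   R^2 and Lambda = {0}, each curve y = c * x ^ 2 with c small has the first
   three properties. Hence the last one: Gamma itself is invariant under ut. *)
Definition local_stable_family (beta : R) (L : M -> set M)
    (Gamma : forall m, set (X m * Y m)) : Prop :=
  [/\ forall m, Lambda m -> L m `<=` ball m e' /\ L m m,
      forall m, Lambda m -> lipschitz_graph beta (Gamma m) /\
        L m = ball m e' `&` phi m @^-1` Gamma m,
      forall m, Lambda m -> (u @` L m) `&` ball (u m) e' `<=` L (u m)
    & forall m, Lambda m ->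
        Gamma m `<=` inverse_image (ut m) (Gamma (u m))].

Definition asymptotic_set (e : M -> R) (m : M) : set M :=
  [set x | lesssim (fun n => mdist (iter n u x) (iter n u m))
                   (fun n => iterprod u e n m)].

Definition stays_close (m : M) : set M :=
  [set x | forall n, ball (iter n u m) e' (iter n u x)].

Definition invariant_lamination (W : M -> set M) : Prop :=
  (forall m1 m2, Lambda m1 -> Lambda m2 ->
     W m1 `&` W m2 !=set0 -> W m1 = W m2) /\
  (forall m, Lambda m -> u @` W m `<=` W (u m)).

End stable_sets.

(* Main.v *)
Require Import Defs.
From HB Require Import structures.
From mathcomp Require Import all_boot all_order all_algebra.
From mathcomp Require Import all_classical all_reals all_analysis.
From mathcomp Require Import ring lra.

Set Implicit Arguments.
Unset Strict Implicit.
Unset Printing Implicit Defensive.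

Import Order.TTheory GRing.Theory Num.Theory.

Local Open Scope classical_set_scope.
Local Open Scope ring_scope.

(* Pulling a beta-Lipschitz map g back through a correspondence amounts to
   solving y = g (F x y), a contraction since alpha * beta < 1; condition (B)
   keeps the result beta-Lipschitz. For families of maps through the points of
   Lambda, measured by sup_x d(f x, g x) / d(x, m), this graph transform
   contracts by lambda_s * lambda_u / (1 - alpha * beta) < 1, and its fixed
   point is the family of global stable graphs. Along an orbit the vertical
   distance to these graphs grows by at least (1 - alpha * beta) / lambda_u per
   step, so an orbit approaching that of m faster than the inverse rate lies on
   them; orbits on the graphs approach at rate lambda_s. The latter gives the
   lamination: once two base orbits are delta-close, the lambda_s along one is
   below e1 along the other. *)

(** * Geometric estimates and fixed points of contractions *)

Lemma geometric_lt {R : realType} (K q d : R) :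
  0 <= q < 1 -> 0 < d -> exists N, forall n, (N <= n)%N -> K * q ^+ n < d.
Proof.
move=> /andP[q0 q1] d0.
have geo : `|q| < 1 by rewrite ger0_norm.
have /cvgrPdist_lt/(_ d d0)[N _ HN] := cvg_geometric K geo.
exists N => n Nn; have := HN n Nn; rewrite /= sub0r normrN.
by apply: le_lt_trans; exact: ler_norm.
Qed.

Lemma geometric_le0 {R : realType} (x K q : R) :
  0 <= q < 1 -> (forall n, x <= K * q ^+ n) -> x <= 0.
Proof.
move=> q01 xK; rewrite leNgt; apply/negP => x0.
have [N /(_ N (leqnn N))] := geometric_lt K q01 x0.
by rewrite ltNge xK.
Qed.

(** Chaining [c * d n <= l n * d n.+1] gives [d 0 <= \prod (l k / c) * d n]. Against the upper bound
    on [d n], each factor [e k * l k / c] is at most [q], so [d 0 <= K * q ^+ n] for all [n]. In the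
    application [d n] is the vertical distance of an orbit to the invariant graphs. *)
Lemma backward_decay {R : realType} (d l e : nat -> R) (K c q : R) :
  0 < c -> 0 <= q < 1 -> 0 <= K -> (forall n, 0 <= l n) ->
  (forall n, 0 <= e n) ->
  (forall n, c * d n <= l n * d n.+1) -> (forall n, e n * l n <= q * c) ->
  (forall n, d n <= K * \prod_(k < n) e k) -> d 0%N <= 0.
Proof.
move=> c0 q01 K0 l0 e0 dl el dK.
have d0n n : d 0%N <= (\prod_(k < n) (l k / c)) * d n.
  elim: n => [|n IH]; first by rewrite big_ord0 mul1r.
  apply: (le_trans IH); rewrite big_ord_recr /= -mulrA.
  apply: ler_wpM2l.
    by apply: prodr_ge0 => k _; rewrite divr_ge0 // ltW.
  by rewrite mulrAC ler_pdivlMr // mulrC.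
apply: (@geometric_le0 _ _ K q) => // n.
apply: (le_trans (d0n n)).
apply: (@le_trans _ _ ((\prod_(k < n) (l k / c)) * (K * \prod_(k < n) e k))).
  by apply: ler_wpM2l => //; apply: prodr_ge0 => k _; rewrite divr_ge0 // ltW.
rewrite mulrCA -big_split /=; apply: ler_wpM2l => //.
rewrite -[in leRHS](card_ord n) -prodr_const.
apply: ler_prod => k _; rewrite !mulr_ge0 ?invr_ge0 ?(ltW c0) //=.
by rewrite mulrAC ler_pdivrMr // mulrC.
Qed.

(** Uniformity in [k] does double duty: it gives the Cauchy property, and it lets the bound pass to
    the limit with the same constant. *)
Lemma complete_geometric_limit {R : realType} (T : completeMetricType R)
    (y : nat -> T) (K q : R) : 0 <= q < 1 ->
  (forall n k, mdist (y n) (y (n + k)%N) <= K * q ^+ n) ->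
  exists l, forall n, mdist (y n) l <= K * q ^+ n.
Proof.
move=> q01 yK.
have : cvg (y @ \oo).
  apply: cauchy_cvg; apply/cauchy_exP => e e0.
  have [N HN] := geometric_lt K q01 e0.
  exists (y N); exists N => // n /= Nn.
  rewrite ballEmdist /= -(subnKC Nn).
  by apply: (le_lt_trans (yK _ _)); exact: HN.
move=> /metricType_numDomainType.cvgrPdist_lt yl.
exists (lim (y @ \oo)) => n; apply/ler_addgt0Pr => e e0.
have [N _ HN] := yl e e0.
have := HN (n + N)%N (leq_addl _ _); rewrite /= metric_sym => /ltW HN'.
apply: (le_trans (metric_triangle _ (y (n + N)%N) _)).
exact: lerD.
Qed.

Lemma contraction_fixpoint {R : realType} (T : completeMetricType R)
    (q : R) (f : T -> T) : 0 <= q < 1 -> lipschitz_le q f ->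
  exists y, y = f y.
Proof.
move=> q01 fq; have /andP[q0 q1] := q01.
pose y n := iter n f (point : T).
(* [D] solves [D = mdist (y 0) (y 1) + q * D], so the ball of radius [D] around the start contains
   the whole Picard orbit. *)
pose D := mdist (y 0%N) (y 1%N) / (1 - q).
have D0 : 0 <= D by rewrite divr_ge0 ?mdist_ge0 // subr_ge0 ltW.
have q1' : 1 - q != 0 by rewrite subr_eq0 eq_sym lt_eqF.
have yD k : mdist (y 0%N) (y k) <= D.
  elim: k => [|k IH]; first by rewrite mdistxx.
  apply: (le_trans (metric_triangle _ (y 1%N) _)).
  have -> : D = mdist (y 0%N) (y 1%N) + q * D by rewrite /D; field.
  apply: lerD => //; apply: (le_trans (fq _ _)).
  exact: ler_wpM2l.
have yq n k : mdist (y n) (y (n + k)%N) <= D * q ^+ n.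
  elim: n => [|n IH]; first by rewrite mulr1 add0n.
  by apply: (le_trans (fq _ _)); rewrite exprS mulrCA; exact: ler_wpM2l.
have [l yl] := complete_geometric_limit q01 yq.
exists l; apply: mdist_positivity; apply/eqP; rewrite eq_le mdist_ge0 andbT.
apply: (@geometric_le0 _ _ (D * (2 * q)) q) => // n.
apply: (le_trans (metric_triangle _ (y n.+1) _)).
have -> : D * (2 * q) * q ^+ n = D * q ^+ n.+1 + q * (D * q ^+ n).
  by rewrite exprS; ring.
apply: lerD; first by rewrite metric_sym.
by apply: (le_trans (fq _ _)); exact: ler_wpM2l.
Qed.

(** * The graph transform of one correspondence *)

Section graph_transform.
Context {R : realType} {X1 Y1 X2 : metricType R} {Y2 : completeMetricType R}.
Variables (H : set ((X1 * Y1) * (X2 * Y2))) (F : X1 -> Y2 -> X2)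
  (G : X1 -> Y2 -> Y1) (alpha beta lambda_s lambda_u : R).
Hypotheses (alpha_ge0 : 0 <= alpha) (beta_ge0 : 0 <= beta)
  (alpha_beta : alpha * beta < 1) (Hgen : generating_map H F G)
  (HA : condA' alpha lambda_u F G) (HB : condB beta lambda_s H).

(** The unknown is the target height: [(F x y, y)] lies on the graph of [g] exactly when
    [y = g (F x y)]. The choice by [get] is total; it is a genuine solution once [g] is
    [beta]-Lipschitz, because the right-hand side then contracts by [alpha * beta]. *)
Definition transform_point (g : X2 -> Y2) (x : X1) : Y2 :=
  get [set y | y = g (F x y)].

Definition graph_transform (g : X2 -> Y2) (x : X1) : Y1 :=
  G x (transform_point g x).

Variable g : X2 -> Y2.
Hypothesis gL : lipschitz_le beta g.

Let gF_contracting x : lipschitz_le (alpha * beta) (fun y => g (F x y)).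
Proof.
move=> y y'; apply: (le_trans (gL _ _)); rewrite (mulrC alpha) -mulrA.
by apply: ler_wpM2l => //; exact: (HA.1 x).
Qed.

Lemma transform_pointE x : transform_point g x = g (F x (transform_point g x)).
Proof.
rewrite /transform_point; case: xgetP => [y _ //|none].
have [|y yE] :=
    @contraction_fixpoint R Y2 (alpha * beta) _ _ (gF_contracting x).
  by rewrite alpha_beta mulr_ge0.
by case: (none y).
Qed.

Lemma graph_transform_orbit x :
  H ((x, graph_transform g x),
     (F x (transform_point g x), transform_point g x)).
Proof. by apply/Hgen. Qed.

(** The image points of two points of the new graph lie on the graph of [g], which is the cone
    hypothesis of (B); its first conclusion is the claim. *)
Lemma lipschitz_graph_transform : lipschitz_le beta (graph_transform g).
Proof.
move=> x x'.
have [] // := HB (graph_transform_orbit x) (graph_transform_orbit x').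
by rewrite {1}transform_pointE {1}(transform_pointE x'); exact: gL.
Qed.

(** The height [b'] is an approximate fixed point of [y |-> g (F a y)] with defect
    [mdist b' (g a')], so it is within that defect over [1 - alpha * beta] of the true one. Applying
    [G a] costs the factor [lambda_u]. *)
Lemma dist_graph_transform a b a' b' : 0 <= lambda_u ->
  H ((a, b), (a', b')) ->
  (1 - alpha * beta) * mdist b (graph_transform g a)
    <= lambda_u * mdist b' (g a').
Proof.
move=> lu0 /Hgen[-> ->]; set c := transform_point g a.
have ab0 : 0 <= 1 - alpha * beta by rewrite subr_ge0 ltW.
have key : (1 - alpha * beta) * mdist b' c <= mdist b' (g (F a b')).
  rewrite mulrBl mul1r lerBlDr.
  apply: (le_trans (metric_triangle _ (g (F a b')) _)).
  by rewrite lerD2l {1}/c transform_pointE; exact: gF_contracting.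
apply: (@le_trans _ _ ((1 - alpha * beta) * (lambda_u * mdist b' c))).
  by apply: ler_wpM2l => //; exact: (HA.2 a).
by rewrite mulrCA; exact: ler_wpM2l.
Qed.

Lemma graph_transform_uniq a b a' b' : 0 <= lambda_u ->
  H ((a, b), (a', b')) -> b' = g a' -> b = graph_transform g a.
Proof.
move=> lu0 Hab b'E; apply: mdist_positivity; apply/eqP.
rewrite eq_le mdist_ge0 andbT -(@pmulr_rle0 _ (1 - alpha * beta)) ?subr_gt0 //.
by apply: (le_trans (dist_graph_transform lu0 Hab)); rewrite b'E mdistxx mulr0.
Qed.

(** This turns the set-theoretic invariance of graphs into a fixed point equation for maps. *)
Lemma inverse_image_graph : 0 <= lambda_u ->
  inverse_image H [set w | w.2 = g w.1]
    = [set z | z.2 = graph_transform g z.1].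
Proof.
move=> lu0; apply/seteqP; split=> [[x y] [[x' y'] [Hxy y'E]]|[x y] /= ->].
  exact: graph_transform_uniq Hxy y'E.
exists (F x (transform_point g x), transform_point g x).
by split; [exact: graph_transform_orbit | exact: transform_pointE].
Qed.

End graph_transform.

(** * The invariant family of Lipschitz graphs through the base points *)

Section invariant_family.
Context {R : realType} {M : Type} (u : M -> M) (Lambda : set M)
  {X : M -> metricType R} {Y : M -> completeMetricType R}.
Variables (p : forall m, X m * Y m)
  (ut : forall m, set ((X m * Y m) * (X (u m) * Y (u m))))
  (F : forall m, X m -> Y (u m) -> X (u m))
  (G : forall m, X m -> Y (u m) -> Y m)
  (alpha beta q : R) (lambda_s lambda_u : M -> R).
Arguments ut : clear implicits.
Arguments F : clear implicits.
Arguments G : clear implicits.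
Hypotheses (uL : forall m, Lambda m -> Lambda (u m))
  (alpha_ge0 : 0 <= alpha) (beta_ge0 : 0 <= beta)
  (alpha_beta : alpha * beta < 1) (q01 : 0 <= q < 1)
  (ls_ge0 : forall m, Lambda m -> 0 <= lambda_s m)
  (lu_ge0 : forall m, Lambda m -> 0 <= lambda_u m)
  (utG : forall m, Lambda m -> generating_map (ut m) (F m) (G m))
  (utA : forall m, Lambda m -> condA' alpha (lambda_u m) (F m) (G m))
  (utB : forall m, Lambda m -> condB beta (lambda_s m) (ut m))
  (p_orbit : forall m, Lambda m -> ut m (p m, p (u m)))
  (gap : forall m, Lambda m ->
     lambda_s m * lambda_u m <= q * (1 - alpha * beta)).

(** Passing through [p m] keeps any two such families within [2 * beta] of each other in the
    distance weighted by [mdist x (p m).1], even when the spaces are unbounded. *)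
Definition based_lipschitz (f : forall m, X m -> Y m) : Prop :=
  forall m, Lambda m -> lipschitz_le beta (f m) /\ f m (p m).1 = (p m).2.

Definition invariant_graphs (f : forall m, X m -> Y m) : Prop :=
  forall m, Lambda m -> f m = graph_transform (F m) (G m) (f (u m)).

Definition pullback (f : forall m, X m -> Y m) (m : M) : X m -> Y m :=
  graph_transform (F m) (G m) (f (u m)).

Lemma iter_Lambda m n : Lambda m -> Lambda (iter n u m).
Proof. by move=> Lm; elim: n => //= n; exact: uL. Qed.

Lemma graph_contracts (g : forall m, X m -> Y m) m a b a' b' a2 b2 a2' b2' :
  Lambda m -> lipschitz_le beta (g (u m)) ->
  ut m ((a, b), (a2, b2)) -> ut m ((a', b'), (a2', b2')) ->
  b2 = g (u m) a2 -> b2' = g (u m) a2' ->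
  mdist a2 a2' <= lambda_s m * mdist a a'.
Proof.
move=> Lm gL H1 H2 E1 E2; have [] // := utB Lm H1 H2.
by rewrite E1 E2; exact: gL.
Qed.

(** By (B), compared with the base orbit, the image of the point of [pullback f] over [x] is closer
    to the base by [lambda_s]. There [f] and [g] differ by at most [K * lambda_s * mdist x (p m).1],
    and [dist_graph_transform] brings this back with the factor [lambda_u / (1 - alpha * beta)]; the
    gap bounds the total factor by [q]. *)
Lemma pullback_dist (f g : forall m, X m -> Y m) (K : R) m :
  0 <= K -> Lambda m -> based_lipschitz f -> based_lipschitz g ->
  (forall x, mdist (f (u m) x) (g (u m) x) <= K * mdist x (p (u m)).1) ->
  forall x, mdist (pullback f x) (pullback g x) <= K * q * mdist x (p m).1.
Proof.
move=> K0 Lm fL gL fg x; have c0 : 0 < 1 - alpha * beta by rewrite subr_gt0.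
have fum := (fL _ (uL Lm)); have gum := (gL _ (uL Lm)).
have H1 := graph_transform_orbit (utG Lm) (f (u m)) x.
have H2 : ut m (((p m).1, (p m).2), ((p (u m)).1, (p (u m)).2)).
  by rewrite -!surjective_pairing; exact: p_orbit.
have E1 := transform_pointE alpha_ge0 beta_ge0 alpha_beta (utA Lm) fum.1 x.
have hx := graph_contracts Lm fum.1 H1 H2 E1 (esym fum.2).
rewrite -(ler_pM2l c0).
apply: (le_trans (dist_graph_transform alpha_ge0 beta_ge0 alpha_beta (utG Lm)
  (utA Lm) gum.1 (lu_ge0 Lm) H1)).
rewrite {1}E1.
apply: (@le_trans _ _
  (lambda_u m * (K * (lambda_s m * mdist x (p m).1)))).
  apply: ler_wpM2l; first exact: lu_ge0.
  by apply: (le_trans (fg _)); exact: ler_wpM2l.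
have -> : lambda_u m * (K * (lambda_s m * mdist x (p m).1)) =
  K * mdist x (p m).1 * (lambda_s m * lambda_u m) by ring.
have -> : (1 - alpha * beta) * (K * q * mdist x (p m).1) =
  K * mdist x (p m).1 * (q * (1 - alpha * beta)) by ring.
by apply: ler_wpM2l; [rewrite mulr_ge0 // mdist_ge0 | exact: gap].
Qed.

Lemma pullback_based f : based_lipschitz f -> based_lipschitz (pullback f).
Proof.
move=> fL m Lm; have fum := (fL _ (uL Lm)); split.
  exact: (lipschitz_graph_transform alpha_ge0 beta_ge0 alpha_beta (utG Lm)
    (utA Lm) (utB Lm) fum.1).
apply/esym.
apply: (graph_transform_uniq alpha_ge0 beta_ge0 alpha_beta (utG Lm) (utA Lm)
   fum.1 (lu_ge0 Lm) (a' := (p (u m)).1) (b' := (p (u m)).2)).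
  by rewrite -!surjective_pairing; exact: p_orbit.
by rewrite fum.2.
Qed.

Lemma based_dist f g m x : based_lipschitz f -> based_lipschitz g ->
  Lambda m -> mdist (f m x) (g m x) <= 2 * beta * mdist x (p m).1.
Proof.
move=> fL gL Lm; apply: (le_trans (metric_triangle _ (p m).2 _)).
have -> : 2 * beta * mdist x (p m).1
  = beta * mdist x (p m).1 + beta * mdist (p m).1 x.
  by rewrite (metric_sym (p m).1); ring.
apply: lerD.
  by rewrite -[X in mdist _ X](fL _ Lm).2; exact: (fL _ Lm).1.
by rewrite -[X in mdist X _](gL _ Lm).2; exact: (gL _ Lm).1.
Qed.

Lemma iter_pullback_based n f :
  based_lipschitz f -> based_lipschitz (iter n pullback f).
Proof. by move=> fL; elim: n => //= n; exact: pullback_based. Qed.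

Lemma iter_pullback_dist n f g m x : based_lipschitz f -> based_lipschitz g ->
  Lambda m -> mdist (iter n pullback f m x) (iter n pullback g m x)
    <= 2 * beta * q ^+ n * mdist x (p m).1.
Proof.
move=> fL gL; have /andP[q0 q1] := q01.
elim: n m x => [|n IH] m x Lm; first by rewrite mulr1; exact: based_dist.
rewrite exprSr mulrA.
apply: pullback_dist => //; try exact: iter_pullback_based.
  by rewrite !mulr_ge0 // exprn_ge0.
by move=> y; apply: IH; exact: uL.
Qed.

Lemma invariant_iter_pullback n f m : invariant_graphs f -> Lambda m ->
  iter n pullback f m = f m.
Proof.
move=> fI; elim: n m => //= n IH m Lm.
by rewrite /pullback /= IH -?fI //; exact: uL.
Qed.

(** Both families are fixed by every iterate of [pullback], while the iterates of any two based
    families approach each other like [q ^+ n]. *)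
Lemma invariant_graphs_uniq f g : based_lipschitz f -> based_lipschitz g ->
  invariant_graphs f -> invariant_graphs g -> forall m, Lambda m -> f m = g m.
Proof.
move=> fL gL fI gI m Lm; apply/funext => x; apply: mdist_positivity.
apply/eqP; rewrite eq_le mdist_ge0 andbT.
apply: (@geometric_le0 _ _ (2 * beta * mdist x (p m).1) q) => // n.
rewrite mulrAC -(invariant_iter_pullback n fI Lm).
by rewrite -(invariant_iter_pullback n gI Lm); exact: iter_pullback_dist.
Qed.

Lemma invariant_graphs_exist :
  exists f, based_lipschitz f /\ invariant_graphs f.
Proof.
pose f0 m (_ : X m) := (p m).2; have /andP[q0 q1] := q01.
have f0L : based_lipschitz f0.
  by move=> m Lm; split => // x x'; rewrite mdistxx mulr_ge0 // mdist_ge0.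
pose fn n := iter n pullback f0.
have lim_ex m x : Lambda m -> exists l, forall n,
    mdist (fn n m x) l <= 2 * beta * mdist x (p m).1 * q ^+ n.
  (* [fn (n + k)] is the [n]-th iterate started from the based family [fn k], so it is comparable
     with [fn n]. *)
  move=> Lm; apply: complete_geometric_limit => // n k.
  rewrite mulrAC /fn iterD.
  by apply: iter_pullback_dist => //; exact: iter_pullback_based.
pose f m x := get [set l | forall n,
    mdist (fn n m x) l <= 2 * beta * mdist x (p m).1 * q ^+ n].
have fP m x n : Lambda m ->
    mdist (fn n m x) (f m x) <= 2 * beta * mdist x (p m).1 * q ^+ n.
  move=> Lm; rewrite /f; case: xgetP => [l _ /(_ n) //|none].
  by have [l /none] := lim_ex _ x Lm.
have fL : based_lipschitz f.
  move=> m Lm; split=> [x x'|].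
    rewrite -subr_le0.
    apply: (@geometric_le0 _ _ (2 * beta * mdist x (p m).1
              + 2 * beta * mdist x' (p m).1) q) => // n.
    rewrite lerBlDr mulrDl.
    apply: (le_trans (metric_triangle _ (fn n m x) _)); rewrite -addrA.
    apply: lerD; first by rewrite metric_sym; exact: fP.
    apply: (le_trans (metric_triangle _ (fn n m x') _)); rewrite [leRHS]addrC.
    apply: lerD; last exact: fP.
    exact: (iter_pullback_based n f0L Lm).1.
  (* At the base point the bound vanishes already for [n = 0], and [fn 0] takes the value [(p m).2]
     there. *)
  apply: mdist_positivity; apply/eqP; rewrite eq_le mdist_ge0 andbT.
  have := fP _ (p m).1 0%N Lm.
  by rewrite metric_sym mdistxx mulr0 mul0r.
exists f; split => // m Lm; apply/funext => x; apply: mdist_positivity.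
apply/eqP; rewrite eq_le mdist_ge0 andbT.
(* The comparison goes through [fn n.+1 = pullback (fn n)]: one [q] is the extra power in its
   distance to [f], the other the contraction of the pair [fn n], [f]. *)
apply: (@geometric_le0 _ _ (2 * beta * mdist x (p m).1 * (2 * q)) q) => // n.
apply: (le_trans (metric_triangle _ (fn n.+1 m x) _)).
have -> : 2 * beta * mdist x (p m).1 * (2 * q) * q ^+ n
  = 2 * beta * mdist x (p m).1 * q ^+ n.+1
    + 2 * beta * q ^+ n * q * mdist x (p m).1 by rewrite exprS; ring.
apply: lerD; first by rewrite metric_sym; exact: fP.
apply: (pullback_dist (f := fn n) (g := f)) => //.
- by rewrite !mulr_ge0 // exprn_ge0.
- exact: iter_pullback_based.
- by move=> y; rewrite mulrAC; apply: fP; exact: uL.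
Qed.

(** * Orbits of the correspondences relative to the invariant graphs *)

Section orbits.
Variable f : forall m, X m -> Y m.
Arguments f : clear implicits.
Hypotheses (fL : based_lipschitz f) (fI : invariant_graphs f).

Variables (m : M) (z : forall n, X (iter n u m) * Y (iter n u m)).
Hypotheses (Lm : Lambda m)
  (z_orbit : forall n, ut (iter n u m) (z n, z n.+1)).

(* Transversally to the invariant graphs an orbit escapes at rate at least
   (1 - alpha * beta) / lambda_u; hence a slower one starts on them. *)
Lemma slow_orbit_on_graph (e : M -> R) (K r : R) : 0 <= K -> 0 <= r < 1 ->
  (forall m', Lambda m' -> 0 <= e m') ->
  (forall m', Lambda m' -> e m' * lambda_u m' <= r * (1 - alpha * beta)) ->
  (forall n, prod_dist (z n) (p (iter n u m)) <= K * iterprod u e n m) ->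
  (z 0%N).2 = f m (z 0%N).1.
Proof.
move=> K0 r01 e0 egap zK; apply: mdist_positivity.
apply/eqP; rewrite eq_le mdist_ge0 andbT.
have c0 : 0 < 1 - alpha * beta by rewrite subr_gt0.
have Ln n : Lambda (iter n u m) by exact: iter_Lambda.
apply: (@backward_decay _ (fun n => mdist (z n).2 (f _ (z n).1))
  (fun n => lambda_u (iter n u m)) (fun n => e (iter n u m))
  (K * (1 + beta)) (1 - alpha * beta) r) => //.
- by rewrite mulr_ge0 // addr_ge0.
- by move=> n; exact: lu_ge0.
- by move=> n; exact: e0.
- move=> n; rewrite (fI (Ln n)).
  apply: (dist_graph_transform alpha_ge0 beta_ge0 alpha_beta (utG (Ln n))
    (utA (Ln n)) (fL (Ln n.+1)).1 (lu_ge0 (Ln n))).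
  by rewrite -!surjective_pairing; exact: z_orbit.
- by move=> n; exact: egap.
(* The graph is [beta]-Lipschitz and contains the base point, so the vertical distance to it is at
   most [1 + beta] times the distance to the base point. *)
- move=> n; rewrite mulrAC.
  apply: (@le_trans _ _ (prod_dist (z n) (p (iter n u m)) * (1 + beta))).
    rewrite mulrDr mulr1.
    apply: (le_trans (metric_triangle _ (p (iter n u m)).2 _)).
    apply: lerD; first by rewrite /prod_dist le_max lexx orbT.
    rewrite -[X in mdist X _](fL (Ln n)).2 metric_sym.
    apply: (le_trans ((fL (Ln n)).1 _ _)); rewrite mulrC.
    by apply: ler_wpM2r => //; rewrite /prod_dist le_max lexx.
  by apply: ler_wpM2r; [rewrite addr_ge0 | exact: zK].
Qed.

(** The orbit and the base orbit lie on the same graphs, so (B) contracts first coordinates by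
    [lambda_s] at each step. Second coordinates are controlled by [beta] times the first; [1 + beta]
    dominates both. *)
Lemma graph_orbit_decay : (forall n, (z n).2 = f _ (z n).1) ->
  forall n, prod_dist (z n) (p (iter n u m)) <=
    (1 + beta) * mdist (z 0%N).1 (p m).1 * iterprod u lambda_s n m.
Proof.
move=> zf; have Ln n : Lambda (iter n u m) by exact: iter_Lambda.
have d1 n : mdist (z n).1 (p (iter n u m)).1 <=
    mdist (z 0%N).1 (p m).1 * iterprod u lambda_s n m.
  elim: n => [|n IH]; first by rewrite /iterprod big_ord0 mulr1.
  rewrite /iterprod big_ord_recr /= mulrA.
  apply: (@le_trans _ _ (lambda_s (iter n u m) *
      mdist (z n).1 (p (iter n u m)).1)).
    apply: (@graph_contracts f _ _ (z n).2 _ (p (iter n u m)).2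
      _ (z n.+1).2 _ (p (iter n.+1 u m)).2 (Ln n) (fL (Ln n.+1)).1).
    - by rewrite -!surjective_pairing; exact: z_orbit.
    - by rewrite -!surjective_pairing; exact: p_orbit.
    - by rewrite zf.
    - by rewrite (fL (Ln n.+1)).2.
  by rewrite mulrC; apply: ler_wpM2r => //; exact: ls_ge0.
move=> n; have h0 := mdist_ge0 (z n).1 (p (iter n u m)).1.
apply: (@le_trans _ _ ((1 + beta) * mdist (z n).1 (p (iter n u m)).1)).
  rewrite /prod_dist ge_max; apply/andP; split.
    by rewrite mulrDl mul1r lerDl mulr_ge0.
  rewrite zf -[X in mdist _ X <= _](fL (Ln n)).2.
  apply: (le_trans ((fL (Ln n)).1 _ _)).
  by rewrite mulrDl mul1r lerDr.
by rewrite -mulrA; apply: ler_wpM2l; [rewrite addr_ge0 | exact: d1].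
Qed.

End orbits.
End invariant_family.

(** * Sets of points asymptotic to a base orbit at a prescribed rate *)

Lemma lesssimP {R : realType} (a b : nat -> R) : (forall n, 0 < b n) ->
  lesssim a b <-> exists2 K, 0 <= K & forall n, a n <= K * b n.
Proof.
move=> b0; split=> [[K Kub]|[K K0 aK]].
  exists (Num.max K 0) => [|n]; first by rewrite le_max lexx orbT.
  have bn : b n != 0 by rewrite gt_eqF.
  rewrite -ler_pdivrMr // mulrC le_max; apply/orP; left.
  by apply: Kub; exists n.
by exists K => _ [n _ <-]; rewrite mulrC ler_pdivrMr.
Qed.

Section asymptotic_sets.
Context {R : realType} {M : metricType R} (u : M -> M) (Lambda : set M).
Hypothesis uL : forall m, Lambda m -> Lambda (u m).
Variable e : M -> R.
Hypothesis e_gt0 : forall m, Lambda m -> 0 < e m.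

Lemma iterprod_gt0 n m : Lambda m -> 0 < iterprod u e n m.
Proof.
by move=> Lm; apply: prodr_gt0 => k _; apply: e_gt0; exact: iter_Lambda.
Qed.

Lemma iterprodS n m : iterprod u e n.+1 m = e m * iterprod u e n (u m).
Proof.
rewrite /iterprod big_ord_recl; congr (_ * _).
by apply: eq_bigr => k _; rewrite -iterSr.
Qed.

Lemma le_iterprod (a : M -> R) n m m' :
  (forall k, 0 <= a (iter k u m) <= e (iter k u m')) ->
  iterprod u a n m <= iterprod u e n m'.
Proof. by move=> ae; apply: ler_prod => k _; exact: ae. Qed.

Lemma asymptotic_setP m x : Lambda m ->
  asymptotic_set u e m x <->
  exists2 K, 0 <= K & forall n,
    mdist (iter n u x) (iter n u m) <= K * iterprod u e n m.
Proof. by move=> Lm; apply: lesssimP => n; exact: iterprod_gt0. Qed.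

Lemma asymptotic_setS m x : Lambda m ->
  asymptotic_set u e (u m) (u x) <-> asymptotic_set u e m x.
Proof.
move=> Lm; have em := e_gt0 Lm; rewrite !asymptotic_setP //; last exact: uL.
split=> -[K K0 xK].
  (* The summand [mdist x m] pays for time 0, which the orbit of [u x] does not see. *)
  exists (K / e m + mdist x m) => [|[|n]].
  - by rewrite addr_ge0 ?mdist_ge0 // divr_ge0 // ltW.
  - by rewrite /iterprod big_ord0 mulr1 /= lerDr divr_ge0 // ltW.
  - rewrite mulrDl iterprodS mulrA divfK ?gt_eqF // !iterSr.
    apply: (le_trans (xK n)); rewrite lerDl.
    by rewrite !mulr_ge0 ?mdist_ge0 ?ltW // iterprod_gt0 //; exact: uL.
exists (K * e m) => [|n]; first by rewrite mulr_ge0 // ltW.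
by rewrite -mulrA -iterprodS -!iterSr.
Qed.

Lemma asymptotic_set_iter N m x : Lambda m ->
  asymptotic_set u e (iter N u m) (iter N u x) <-> asymptotic_set u e m x.
Proof.
move=> Lm; elim: N => [//|N <-] /=.
by apply: asymptotic_setS; exact: iter_Lambda.
Qed.

Lemma asymptotic_set_close s m x d :
  (forall m', Lambda m' -> e m' <= s) -> s < 1 ->
  Lambda m -> asymptotic_set u e m x -> 0 < d ->
  exists N, forall n, (N <= n)%N -> mdist (iter n u x) (iter n u m) < d.
Proof.
move=> es s1 Lm /(asymptotic_setP _ Lm)[K K0 xK] d0.
have s01 : 0 <= s < 1.
  by rewrite s1 andbT (le_trans _ (es _ Lm)) // ltW // e_gt0.
have [N HN] := geometric_lt K s01 d0.
exists N => n Nn; apply: le_lt_trans (HN n Nn); apply: (le_trans (xK n)).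
apply: ler_wpM2l => //; rewrite -[in leRHS](card_ord n) -prodr_const.
apply: ler_prod => k _; have Lk := iter_Lambda uL k Lm.
by rewrite es // ltW // e_gt0.
Qed.

End asymptotic_sets.

(** * Local stable sets in [M], read through the charts [phi] *)

Section local_stable_sets.
Context {R : realType} {M : metricType R} (u : M -> M) (Lambda : set M)
  {X : M -> metricType R} {Y : M -> completeMetricType R}.
Variables (e' C : R) (phi : forall m, M -> X m * Y m)
  (ut : forall m, set ((X m * Y m) * (X (u m) * Y (u m))))
  (F : forall m, X m -> Y (u m) -> X (u m))
  (G : forall m, X m -> Y (u m) -> Y m)
  (alpha beta : R) (lambda_s lambda_u : M -> R).
Arguments ut : clear implicits.
Arguments F : clear implicits.
Arguments G : clear implicits.
Hypotheses (uL : forall m, Lambda m -> Lambda (u m))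
  (e'_gt0 : 0 < e') (C_gt0 : 0 < C)
  (phi_bilip : forall m, Lambda m -> bilipschitz_on C (ball m e') (phi m))
  (alpha_ge0 : 0 <= alpha) (beta_ge0 : 0 <= beta)
  (alpha_beta : alpha * beta < 1)
  (ls_ge0 : forall m, Lambda m -> 0 <= lambda_s m)
  (lu_ge0 : forall m, Lambda m -> 0 <= lambda_u m)
  (utG : forall m, Lambda m -> generating_map (ut m) (F m) (G m))
  (utA : forall m, Lambda m -> condA' alpha (lambda_u m) (F m) (G m))
  (utB : forall m, Lambda m -> condB beta (lambda_s m) (ut m))
  (u_ut : locally_equal Lambda e' phi ut).

Lemma local_orbit m x : Lambda m -> ball m e' x -> ball (u m) e' (u x) ->
  ut m (phi m x, phi (u m) (u x)).
Proof.
move=> Lm bx bux; have E := u_ut Lm bx bux.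
by have : value (ut m) (phi m x) (phi (u m) (u x)) by rewrite E.
Qed.

Lemma center_orbit m : Lambda m -> ut m (phi m m, phi (u m) (u m)).
Proof. by move=> Lm; apply: local_orbit => //; exact: ballxx. Qed.

Variable f : forall m, X m -> Y m.
Arguments f : clear implicits.
Hypotheses (fL : based_lipschitz Lambda (fun m => phi m m) beta f)
  (fI : invariant_graphs Lambda F G f).

Definition local_graph (m : M) : set M :=
  ball m e' `&` phi m @^-1` [set z | z.2 = f m z.1].

(** Staying close makes the charted points an orbit of the correspondences, and the upper
    bi-Lipschitz bound carries the rate over at the cost of [C]; [slow_orbit_on_graph] then
    applies. *)
Lemma slow_in_local_graph (e : M -> R) r m x : 0 <= r < 1 ->
  (forall m', Lambda m' -> 0 < e m') ->
  (forall m', Lambda m' -> e m' * lambda_u m' <= r * (1 - alpha * beta)) ->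
  Lambda m -> stays_close u e' m x -> asymptotic_set u e m x ->
  local_graph m x.
Proof.
move=> r01 e0 egap Lm xclose /(asymptotic_setP uL e0 _ Lm)[K K0 xK].
have Ln n : Lambda (iter n u m) by exact: iter_Lambda.
split; first exact: (xclose 0%N).
apply: (slow_orbit_on_graph uL alpha_ge0 beta_ge0 alpha_beta lu_ge0 utG utA
  fL fI (z := fun n => phi (iter n u m) (iter n u x)) Lm _ (e := e)
  (K := C * K) (r := r)) => //.
- move=> n.
  by apply: (local_orbit (Ln n)); [exact: (xclose n) | exact: (xclose n.+1)].
- by rewrite mulr_ge0 // ltW.
- by move=> m' Lm'; exact/ltW/e0.
- move=> n; have /andP[_] := phi_bilip (Ln n) (xclose n) (ballxx _ e'_gt0).
  move=> h; apply: (le_trans h); rewrite -mulrA.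
  by apply: ler_wpM2l; [exact: ltW | exact: xK].
Qed.

(** The lower bi-Lipschitz bound brings [graph_orbit_decay] back to [M]. *)
Lemma local_graph_decay m x : Lambda m ->
  (forall n, local_graph (iter n u m) (iter n u x)) ->
  exists2 K, 0 <= K & forall n,
    mdist (iter n u x) (iter n u m) <= K * iterprod u lambda_s n m.
Proof.
move=> Lm xL; have Ln n : Lambda (iter n u m) by exact: iter_Lambda.
exists (C * ((1 + beta) * mdist (phi m x).1 (phi m m).1)) => [|n].
  by rewrite !mulr_ge0 ?mdist_ge0 ?addr_ge0 // ltW.
have /andP[h _] := phi_bilip (Ln n) (xL n).1 (ballxx _ e'_gt0).
rewrite mulrC ler_pdivrMr // mulrC in h.
apply: (le_trans h); rewrite -mulrA; apply: ler_wpM2l; first exact: ltW.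
apply: (graph_orbit_decay uL beta_ge0 ls_ge0 utB center_orbit fL
  (z := fun n => phi (iter n u m) (iter n u x)) Lm).
- move=> k.
  by apply: (local_orbit (Ln k)); [exact: (xL k).1 | exact: (xL k.+1).1].
- by move=> k; exact: (xL k).2.
Qed.

Lemma local_graph_asymptotic (e : M -> R) m x : Lambda m ->
  (forall m', Lambda m' -> 0 < e m') ->
  (forall m', Lambda m' -> lambda_s m' <= e m') ->
  (forall n, local_graph (iter n u m) (iter n u x)) ->
  asymptotic_set u e m x.
Proof.
move=> Lm e0 lse /(local_graph_decay Lm)[K K0 xK].
apply/(asymptotic_setP uL e0 _ Lm); exists K => // n; apply: (le_trans (xK n)).
apply: ler_wpM2l => //; apply: le_iterprod => k.
by have Lk := iter_Lambda uL k Lm; rewrite ls_ge0 // lse.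
Qed.

Lemma iter_local_graph m x : (forall m', Lambda m' ->
    u @` local_graph m' `<=` local_graph (u m')) ->
  Lambda m -> local_graph m x ->
  forall n, local_graph (iter n u m) (iter n u x).
Proof.
move=> ul Lm xm; elim=> [//|n IH] /=; apply: ul; first exact: iter_Lambda.
by exists (iter n u x).
Qed.

(** * Strong stable sets and their independence of the base point *)

Section strong_stable.
Variables (e1 : M -> R) (r s : R).
Hypotheses (r01 : 0 <= r < 1) (s1 : s < 1)
  (e1_gt0 : forall m, Lambda m -> 0 < e1 m)
  (e1_gap : forall m, Lambda m -> e1 m * lambda_u m <= r * (1 - alpha * beta))
  (e1_le : forall m, Lambda m -> e1 m <= s).

(** Since [e1 <= s < 1], the orbit is eventually within [e'] of the base orbit for good; from then
    on slowness places it on the graphs. *)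
Lemma asymptotic_eventually_local m x : Lambda m -> asymptotic_set u e1 m x ->
  exists N, forall n, (N <= n)%N -> local_graph (iter n u m) (iter n u x).
Proof.
move=> Lm xm.
have [N HN] := asymptotic_set_close uL e1_gt0 e1_le s1 Lm xm e'_gt0.
exists N => n Nn; apply: (slow_in_local_graph r01 e1_gt0 e1_gap).
- exact: iter_Lambda.
- move=> k; rewrite -!iterD ballEmdist /= metric_sym; apply: HN.
  exact: (leq_trans Nn (leq_addl _ _)).
- exact/(asymptotic_set_iter uL e1_gt0 n x Lm).
Qed.

(** Through [y] the two base orbits become [delta]-close. As [e1] carries no continuity, its values
    along them cannot be compared directly. Instead [x] and [y] eventually lie on the local graphs
    of [m1], where the better rate [lambda_s] holds, and this rate is below [e1] along [m2]. *)
Lemma asymptotic_set_change_base (eps delta : R) m1 m2 y : 0 < delta ->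
  (forall m, Lambda m -> lambda_s m + eps < e1 m) ->
  (forall m m', Lambda m -> Lambda m' -> mdist m m' < delta ->
     `|lambda_s m - lambda_s m'| < eps) ->
  Lambda m1 -> Lambda m2 ->
  asymptotic_set u e1 m1 y -> asymptotic_set u e1 m2 y ->
  asymptotic_set u e1 m1 `<=` asymptotic_set u e1 m2.
Proof.
move=> d0 lse ls_unif L1 L2 y1 y2 x x1.
have d20 : 0 < delta / 2 by rewrite divr_gt0.
have [N1 HN1] := asymptotic_eventually_local L1 x1.
have [N2 HN2] := asymptotic_eventually_local L1 y1.
have [N3 HN3] := asymptotic_set_close uL e1_gt0 e1_le s1 L1 y1 d20.
have [N4 HN4] := asymptotic_set_close uL e1_gt0 e1_le s1 L2 y2 d20.
pose N := maxn (maxn N1 N2) (maxn N3 N4).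
have [N1N N2N N3N N4N] :
    [/\ (N1 <= N)%N, (N2 <= N)%N, (N3 <= N)%N & (N4 <= N)%N].
  by rewrite /N !leq_max !leqnn !orbT.
have LN1 := iter_Lambda uL N L1; have LN2 := iter_Lambda uL N L2.
(* [lambda_s] varies by less than [eps] between the close orbits, and [e1] exceeds [lambda_s] by
   more than [eps]. *)
have ls_e1 k : 0 <= lambda_s (iter k u (iter N u m1))
    <= e1 (iter k u (iter N u m2)).
  have Lk1 := iter_Lambda uL k LN1; have Lk2 := iter_Lambda uL k LN2.
  rewrite ls_ge0 //=; apply/ltW/(lt_trans _ (lse _ Lk2)); rewrite -ltrBlDl.
  apply: (le_lt_trans (ler_norm _)); apply: ls_unif => //.
  rewrite -!iterD (splitr delta).
  apply: (le_lt_trans (metric_triangle _ (iter (k + N) u y) _)).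
  apply: ltrD; [rewrite metric_sym; apply: HN3 | apply: HN4];
    exact: (leq_trans _ (leq_addl _ _)).
have graph_part w : (forall k, local_graph (iter k u (iter N u m1))
      (iter k u (iter N u w))) ->
    exists2 K, 0 <= K & forall k, mdist (iter k u (iter N u w))
      (iter k u (iter N u m1)) <= K * iterprod u e1 k (iter N u m2).
  move=> /(local_graph_decay LN1)[K K0 wK]; exists K => // k.
  by apply: (le_trans (wK k)); apply: ler_wpM2l => //; exact: le_iterprod.
have [k|Kx Kx0 xK] := graph_part x; first
  by rewrite -!iterD; apply: HN1; exact: (leq_trans N1N (leq_addl _ _)).
have [k|Ky Ky0 yK] := graph_part y; first
  by rewrite -!iterD; apply: HN2; exact: (leq_trans N2N (leq_addl _ _)).
have /(asymptotic_setP uL e1_gt0 _ LN2)[K K0 y2K] :=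
  (asymptotic_set_iter uL e1_gt0 N y L2).2 y2.
apply/(asymptotic_set_iter uL e1_gt0 N x L2)/(asymptotic_setP uL e1_gt0 _ LN2).
exists (Kx + (Ky + K)) => [|k]; first by rewrite !addr_ge0.
rewrite !mulrDl.
(* The path is [x], [m1], [y], [m2]: two legs decay on the graphs of [m1], the last one because [y]
   belongs to the set of [m2]. *)
apply: (le_trans (metric_triangle _ (iter k u (iter N u m1)) _)).
apply: lerD => //.
apply: (le_trans (metric_triangle _ (iter k u (iter N u y)) _)).
by apply: lerD => //; rewrite metric_sym.
Qed.

End strong_stable.
End local_stable_sets.

(** * Uniform constants extracted from the rate conditions *)

Lemma lrate_lt {R : realType} (ab l t : R) : ab < 1 -> 0 <= l ->
  (t%:E < lrate ab l)%E -> t * l < 1 - ab.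
Proof.
move=> ab1; rewrite le_eqVlt => /orP[/eqP <- _|l0].
  by rewrite mulr0 subr_gt0.
by rewrite /lrate inver gt_eqF // -EFinM lte_fin mulrC ltr_pdivlMr.
Qed.

Lemma lt_minB_lrate {R : realType} (ab l t s : R) : ab < 1 -> 0 <= l ->
  (t%:E < Order.min 1 (lrate ab l) - s%:E)%E ->
  t + s < 1 /\ (t + s) * l < 1 - ab.
Proof.
move=> ab1 l0; rewrite lteBrDr // -EFinD lt_min => /andP[h1 h2].
by split; [rewrite -lte_fin | exact: lrate_lt h2].
Qed.

(* A margin below min 1 ((1 - ab) / l) gives one below 1 - ab for t * l, also
   when l is close to 0: there t < 1 suffices. *)
Lemma uniform_gap {R : realType} (ab l t s : R) : ab < 1 -> 0 <= l -> 0 < s ->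
  t + s < 1 -> (t + s) * l < 1 - ab ->
  t * l <= Num.max 2^-1 (1 - s / 2) * (1 - ab).
Proof.
move=> ab1 l0 s0 ts tsl; have c0 : 0 < 1 - ab by rewrite subr_gt0.
(* Above the threshold, [s * l] is at least [s / 2 * (1 - ab)], which is the margin; below it,
   [t < 1] gives [t * l <= l], at most half of [1 - ab]. *)
have [hl|hl] := lerP ((1 - ab) / 2) l.
  apply: (@le_trans _ _ ((1 - s / 2) * (1 - ab))); first by nra.
  by apply: ler_wpM2r; [exact: ltW | rewrite le_max lexx orbT].
apply: (@le_trans _ _ (2^-1 * (1 - ab))); first by nra.
by apply: ler_wpM2r; [exact: ltW | rewrite le_max lexx].
Qed.

Lemma sup_lt_ratio {R : realType} {T : Type} (A : set T) (g : T -> R) (c : R) :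
  0 < c -> has_ubound [set g x | x in A] -> sup [set g x | x in A] < c ->
  exists2 r, 0 <= r < 1 & forall x, A x -> g x <= r * c.
Proof.
(* The supremum over [c] is below 1 but may be negative; the maximum with 0 restores [0 <= r]. *)
move=> c0 gub gc; exists (Num.max 0 (sup [set g x | x in A] / c)).
  by rewrite le_max lexx /= gt_max ltr01 ltr_pdivrMr // mul1r.
move=> x Ax; apply: (@le_trans _ _ (sup [set g x | x in A] / c * c)).
  by rewrite divfK ?gt_eqF //; apply: ub_le_sup => //; exists x.
by apply: ler_wpM2r; [exact: ltW | rewrite le_max lexx orbT].
Qed.

(** * Assembly: existence, uniqueness, characterization by rates, lamination *)

Theorem theorem7p9 (R : realType) (M : metricType R) (u : M -> M)
    (Lambda : set M) (X Y : M -> completeMetricType R)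
    (e' C : R) (phi : forall m, M -> X m * Y m)
    (ut : forall m, set ((X m * Y m) * (X (u m) * Y (u m))))
    (F : forall m, X m -> Y (u m) -> X (u m))
    (G : forall m, X m -> Y (u m) -> Y m)
    (alpha beta eps : R) (lambda_s lambda_u : M -> R)
  (u_cont : continuous u)
  (uLambda : u @` Lambda `<=` Lambda)
  (e'_gt0 : 0 < e') (C_gt0 : 0 < C)
  (phi_bilip : forall m, Lambda m -> bilipschitz_on C (ball m e') (phi m))
  (alpha_gt0 : 0 < alpha) (beta_gt0 : 0 < beta) (eps_gt0 : 0 < eps)
  (lambda_s_ge0 : forall m, Lambda m -> 0 <= lambda_s m)
  (lambda_u_ge0 : forall m, Lambda m -> 0 <= lambda_u m)
  (lambda_s_bnd : has_ubound [set lambda_s m | m in Lambda])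
  (lambda_u_bnd : has_ubound [set lambda_u m | m in Lambda])
  (ut_nonempty : forall m, Lambda m -> ut m !=set0)
  (ut_gen : forall m, Lambda m -> generating_map (ut m) (F m) (G m))
  (utA : forall m, Lambda m -> condA' alpha (lambda_u m) (F m) (G m))
  (utB : forall m, Lambda m -> condB beta (lambda_s m) (ut m))
  (u_ut : locally_equal Lambda e' phi ut)
  (alpha_beta : alpha * beta < 1)
  (spectral_gap :
     sup [set (lambda_s m + eps) * lambda_u m | m in Lambda]
       < 1 - alpha * beta) :
  exists L : M -> set M,
  [/\ (* existence for (1), (2) *)
      exists Gamma, local_stable_family Lambda e' phi ut beta L Gamma,
      (* uniqueness *)
      forall L' Gamma', local_stable_family Lambda e' phi ut beta L' Gamma' ->
        forall m, Lambda m -> L' m = L m,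
      (* (3) *)
      forall e : M -> R,
        (forall m, Lambda m -> lambda_s m + eps < e m /\
           ((e m)%:E < lrate (alpha * beta) (lambda_u m))%E) ->
        sup [set e m * lambda_u m | m in Lambda] < 1 - alpha * beta ->
        (forall m, Lambda m ->
           stays_close u e' m `&` asymptotic_set u e m `<=` L m) /\
        ((forall m, Lambda m -> u @` L m `<=` L (u m)) ->
         forall m, Lambda m ->
           stays_close u e' m `&` asymptotic_set u e m = L m)
    & (* (4) *)
      forall (delta varsigma : R) (e1 : M -> R),
        sup [set lambda_s m | m in Lambda] + eps < 1 ->
        0 < delta ->
        (forall m1 m2, Lambda m1 -> Lambda m2 -> mdist m1 m2 < delta ->
           `|lambda_s m1 - lambda_s m2| < eps) ->
        0 < varsigma ->
        (forall m, Lambda m -> lambda_s m + eps < e1 m /\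
           ((e1 m)%:E < Order.min 1 (lrate (alpha * beta) (lambda_u m))
                        - varsigma%:E)%E) ->
        let LambdaS m :=
          \bigcup_(n in [set: nat]) iter n u @^-1` L (iter n u m) in
        [/\ forall m, Lambda m -> asymptotic_set u e1 m `<=` LambdaS m,
            (forall m, Lambda m -> u @` L m `<=` L (u m)) ->
              forall m, Lambda m -> LambdaS m = asymptotic_set u e1 m
          & invariant_lamination u Lambda (asymptotic_set u e1)]].
Proof.
have uL m : Lambda m -> Lambda (u m) by move=> Lm; apply: uLambda; exists m.
have alpha_ge0 := ltW alpha_gt0; have beta_ge0 := ltW beta_gt0.
have c0 : 0 < 1 - alpha * beta by rewrite subr_gt0.
pose p m := phi m m.
have [a lsa] := lambda_s_bnd; have [b lub] := lambda_u_bnd.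
have ls_le m : Lambda m -> lambda_s m <= a by move=> Lm; apply: lsa; exists m.
have lu_le m : Lambda m -> lambda_u m <= b by move=> Lm; apply: lub; exists m.
(* Boundedness makes the [sup] of the gap condition a true upper bound; on an unbounded set it would
   be 0 by convention. *)
have gap_ub : has_ubound [set (lambda_s m + eps) * lambda_u m | m in Lambda].
  exists ((a + eps) * b) => _ [m Lm <-].
  apply: ler_pM; rewrite ?addr_ge0 ?ls_le ?lerD2r ?ls_le ?lu_le //.
  + exact: lambda_s_ge0.
  + exact: ltW.
  + exact: lambda_u_ge0.
have [q q01 qgap] := sup_lt_ratio c0 gap_ub spectral_gap.
have gap m : Lambda m -> lambda_s m * lambda_u m <= q * (1 - alpha * beta).
  move=> Lm; apply: le_trans (qgap m Lm); apply: ler_wpM2r.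
    exact: lambda_u_ge0.
  by rewrite lerDl ltW.
have p_orbit m : Lambda m -> ut m (p m, p (u m)) .
  exact: (center_orbit e'_gt0 u_ut).
have uniq := invariant_graphs_uniq uL alpha_ge0 beta_ge0 alpha_beta q01
  lambda_u_ge0 ut_gen utA utB p_orbit gap.
have [f [fL fI]] := invariant_graphs_exist uL alpha_ge0 beta_ge0 alpha_beta q01
  lambda_u_ge0 ut_gen utA utB p_orbit gap.
pose L := local_graph e' phi f.
have slow e r m x := slow_in_local_graph uL e'_gt0 C_gt0 phi_bilip alpha_ge0
  beta_ge0 alpha_beta lambda_u_ge0 ut_gen utA u_ut fL fI (e := e) (r := r)
  (m := m) (x := x).
have asymp e m x := local_graph_asymptotic uL e'_gt0 C_gt0 phi_bilip
  beta_ge0 lambda_s_ge0 utB u_ut fL (e := e) (m := m) (x := x).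
have e_gt0 (e : M -> R) : (forall m, Lambda m -> lambda_s m + eps < e m) ->
    forall m, Lambda m -> 0 < e m.
  move=> lse m Lm; apply: lt_trans (lse m Lm).
  by rewrite ltr_wpDl // lambda_s_ge0.
have lsW (e : M -> R) : (forall m, Lambda m -> lambda_s m + eps < e m) ->
    forall m, Lambda m -> lambda_s m <= e m.
  move=> lse m Lm; apply: ltW; apply: le_lt_trans (lse m Lm).
  by rewrite lerDl ltW.
have preim (g : forall m, X m -> Y m) m : Lambda m ->
    lipschitz_le beta (g (u m)) ->
    inverse_image (ut m) [set w | w.2 = g (u m) w.1]
      = [set z | z.2 = graph_transform (F m) (G m) (g (u m)) z.1].
  move=> Lm gL; exact: (inverse_image_graph alpha_ge0 beta_ge0 alpha_beta
    (ut_gen _ Lm) (utA _ Lm) gL (lambda_u_ge0 _ Lm)).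
exists L; split.
- have f_preim m : Lambda m ->
      [set z | z.2 = f m z.1]
        = inverse_image (ut m) [set w | w.2 = f (u m) w.1].
    by move=> Lm; rewrite preim // -?fI //; exact: (fL _ (uL m Lm)).1.
  exists (fun m => [set z | z.2 = f m z.1]); split=> m Lm.
  + split; first by move=> x [].
    by split; [exact: ballxx | exact/esym/(fL m Lm).2].
  + by split=> //; exists (f m) => //; exact: (fL m Lm).1.
  + move=> _ [[x [bx xf] <-] bux]; split=> //.
    (* Some value of the correspondence at [phi m x] lies on the next graph; since [u x] is in the
       ball, the only value is [phi (u m) (u x)]. *)
    move: xf; rewrite (f_preim m Lm) => -[w [wx wf]].
    by move: wx; rewrite (u_ut _ _ Lm bx bux) => wE; rewrite wE in wf.
  + by rewrite (f_preim m Lm).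
- move=> L' Gamma' [L'm GammaL _ Gamma_inv].
  (* Off [Lambda] a constant map serves as a dummy, so that a whole family can be chosen. *)
  have g_ex m : exists g : X m -> Y m, Lambda m ->
      lipschitz_le beta g /\ Gamma' m = [set z | z.2 = g z.1].
    have [Lm|nLm] := pselect (Lambda m); last by exists (fun=> point).
    by have [[g gL gE] _] := GammaL m Lm; exists g.
  pose g m := projT1 (cid (g_ex m)).
  have gP m : Lambda m ->
      lipschitz_le beta (g m) /\ Gamma' m = [set z | z.2 = g m z.1].
    exact: projT2 (cid (g_ex m)).
  have gL : based_lipschitz Lambda p beta g.
    move=> m Lm; have [gl gE] := gP m Lm; split => //.
    have [_] := L'm m Lm; rewrite (GammaL m Lm).2 gE => -[_ /=].
    exact: esym.
  (* [Gamma' m] is included in the preimage of the next graph; both are graphs over all of [X m], so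
     the inclusion gives equality of the maps. *)
  have gI : invariant_graphs Lambda F G g.
    move=> m Lm; apply/funext => x.
    have := Gamma_inv m Lm (x, g m x).
    have [gum gumE] := gP _ (uL m Lm).
    by rewrite (gP m Lm).2 gumE preim //; exact.
  move=> m Lm; rewrite (GammaL m Lm).2 (gP m Lm).2.
  by rewrite (uniq g f gL fL gI fI m Lm).
- move=> e eP e_gap; have lse m Lm := (eP m Lm).1.
  have e0 := e_gt0 e lse.
  have elu_ub : has_ubound [set e m * lambda_u m | m in Lambda].
    exists (1 - alpha * beta) => _ [m Lm <-]; apply: ltW.
    by apply: lrate_lt (eP m Lm).2 => //; exact: lambda_u_ge0.
  have [r r01 rgap] := sup_lt_ratio c0 elu_ub e_gap.
  have sub m : Lambda m ->
      stays_close u e' m `&` asymptotic_set u e m `<=` L m.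
    by move=> Lm x [xc xe]; exact: (slow e r).
  split=> // uLL m Lm; apply/seteqP; split; first exact: sub.
  (* Full invariance keeps the orbit on the local graphs forever, hence in the balls and decaying at
     rate [lambda_s]. *)
  move=> x xL; have xLn := iter_local_graph uL uLL Lm xL.
  split; first by move=> n; exact: (xLn n).1.
  by apply: asymp => //; exact: lsW.
- move=> delta s e1 _ delta0 ls_unif s0 e1P LambdaS.
  have lse m Lm := (e1P m Lm).1.
  have e0 := e_gt0 e1 lse.
  have e1s m : Lambda m ->
      e1 m + s < 1 /\ (e1 m + s) * lambda_u m < 1 - alpha * beta.
    move=> Lm; apply: lt_minB_lrate (e1P m Lm).2 => //; exact: lambda_u_ge0.
  (* The margin [s] yields both uniform constants: the ratio [r] for the transverse gap, and [1 - s]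
     as a bound on [e1]. *)
  pose r := Num.max 2^-1 (1 - s / 2).
  have r01 : 0 <= r < 1.
    by rewrite le_max invr_ge0 ler0n /= gt_max; apply/andP; split; lra.
  have rgap m : Lambda m -> e1 m * lambda_u m <= r * (1 - alpha * beta).
    move=> Lm; have [h1 h2] := e1s m Lm.
    by apply: uniform_gap h1 h2 => //; exact: lambda_u_ge0.
  have e1_le m : Lambda m -> e1 m <= 1 - s.
    by move=> Lm; have [h1 _] := e1s m Lm; lra.
  have s1 : 1 - s < 1 by lra.
  have sub m : Lambda m -> asymptotic_set u e1 m `<=` LambdaS m.
    move=> Lm x xe.
    have [N /(_ N (leqnn N)) HN] := asymptotic_eventually_local uL e'_gt0 C_gt0
      phi_bilip alpha_ge0 beta_ge0 alpha_beta lambda_u_ge0 ut_gen utA u_ut fL fI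
      r01 s1 e0 rgap e1_le Lm xe.
    by exists N.
  split=> //.
    move=> uLL m Lm; apply/seteqP; split; last exact: sub.
    (* The asymptotic condition is insensitive to finitely many steps, so it can be checked from
       time [N] on, where the orbit is on the local graphs. *)
    move=> x [N _ xN]; apply/(asymptotic_set_iter uL e0 N x Lm).
    have LN := iter_Lambda uL N Lm.
    apply: asymp => //; first exact: lsW.
    exact: (iter_local_graph uL uLL LN xN).
  split=> [m1 m2 L1 L2 [y [y1 y2]]|m Lm _ [x xe <-]].
    have base := asymptotic_set_change_base uL e'_gt0 C_gt0
      phi_bilip alpha_ge0 beta_ge0 alpha_beta lambda_s_ge0 lambda_u_ge0 ut_gen
      utA utB u_ut fL fI r01 s1 e0 rgap e1_le delta0 lse ls_unif.
    by apply/seteqP; split; [exact: (base m1 m2 y) | exact: (base m2 m1 y)].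
  exact/(asymptotic_setS uL e0 x Lm).
Qed.
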